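(* Let $n\in\mathbb{Z}_+^d$ be a prebasis and let $A$ be a $d\times d'$ natural number matrix all of whose rows contain a positive integer. Then $\mathrm{M}_{A,n}:X_n\to X_{n^A}$ and $\mu_{A,n}:X_{n^A}\to X_n$ are inverse maps of each other.
   Context: $\mathbb{N}=\{0,1,2,\dots\}$, $\mathbb{Z}_+$ is the set of positive integers, $\Sigma_N=\{0,\dots,N-1\}$. Vectors are ordered coordinatewise; $\mathbf{0},\mathbf{1}$ are constant vectors; $e_i$ are the standard basis vectors. A prebasis of dimension $d$ is any $n\in\mathbb{Z}_+^d$; put $N=\prod_i n[i]$ and $m(n,v)=\prod_{j=1}^d n[j]^{-v[j]}$ for $v\in\mathbb{Z}^d$. **Cubes.** For $a\in\mathbb{N}$ and $\mathbf{0}\ge v_1\ge v_2$ in $\mathbb{Z}^d$, $\mathrm{base}_n(a,(v_1,v_2))[2]$ denotes the integer $a_1$ in the unique representation $a=a_0+a_1m(n,v_1)+a_2m(n,v_2)$ with integers $0\le a_0<m(n,v_1)$, $0\le a_1<m(n,v_2)/m(n,v_1)$, $a_2\ge0$. For $a\in\Sigma_N$, $\mathrm{cube}_n(a)$ is the function on pairs $v_1\ge v_2$ in $\{-1,0\}^d$ given by $\mathrm{cube}_n(a)[v_1,v_2]=\mathrm{base}_n(a,(v_1,v_2))[2]$; $T_n=\{\mathrm{cube}_n(a):a\in\Sigma_N\}$. $X_n$ is the set of maps $f:\mathbb{Z}^d\to T_n$ such that $f[z][\mathbf{0},-\mathbf{1}+e_i]=f[z+e_i][-e_i,-\mathbf{1}]$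 for all $z\in\mathbb{Z}^d$, $1\le i\le d$. **Labels.** For $f\in X_n$ the edge $\{z-e_i,z\}$ has label $\lambda(f,\{z-e_i,z\})=f[z][\mathbf{0},-e_i]$. If $p'-p=ae_j$ with $a=\pm1$, $(p,p')f=a\,m(n,\max\{p,p'\})\lambda(f,\{p,p'\})$. For general $p,p'\in\mathbb{Z}^d$, $(p,p')f=\sum_i(P_i,P_{i+1})f$ over any path of unit steps from $p$ to $p'$ (independent of the path), and $\lambda(f,(p,p'))=(p,p')f/m(n,p')$. **Macrotile map.** For a $d\times d'$ matrix $A$ over $\mathbb{N}$, $n^A\in\mathbb{Z}_+^{d'}$ is the prebasis $n^A[i]=m(n,-Ae_i)$, and $\mathrm{M}_{A,n}:X_n\to X_{n^A}$ is $\mathrm{M}_{A,n}(f)[v]=\mathrm{cube}_{n^A}(\lambda(f,(A(v-\mathbf{1}),Av)))$ for $v\in\mathbb{Z}^{d'}$ (this is indeed an element of $X_{n^A}$). **Microtile map.** If every row of $A$ contains a positive integer, $\mu_{A,n}:X_{n^A}\to X_n$ is defined as follows: for $f\in X_{n^A}$ and $x\in\mathbb{Z}^d$ choose $z_1\in\mathbb{Z}^{d'}$ with $v:=Az_1-x\ge\mathbf{0}$ and $z_2\in\mathbb{Z}^{d'}$ with $z_2\le z_1$ and $Az_2\le x-\mathbf{1}$, let $a=\lambda(f,(z_2,z_1))\in\mathbb{N}$, and put $\mu_{A,n}(f)[x]=\mathrm{cube}_n(\mathrm{base}_n(a,(-v,-v-\mathbf{1}))[2])$ (independent of the choices of $z_1,z_2$,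 and the result is in $X_n$). *)

(* Defs.v *)
From mathcomp Require Import all_boot all_order all_algebra.
From mathcomp Require Import zify.
From mathcomp Require Import mathcomp_extra boolp classical_sets functions.

Set Implicit Arguments.
Unset Strict Implicit.
Unset Printing Implicit Defensive.
Import Order.TTheory GRing.Theory Num.Theory.
Local Open Scope ring_scope.

Notation ivec d := 'cV[int]_d.

Definition ones d : ivec d := const_mx 1.
Definition basis_vec d (i : 'I_d) : ivec d := delta_mx i 0.
Definition vle d (u v : ivec d) : bool := [forall i, u i 0 <= v i 0].
Definition vmax d (u v : ivec d) : ivec d :=
  \col_i Num.max (u i 0) (v i 0).

Definition prebasis d (n : 'I_d -> nat) : Prop := forall i, (0 < n i)%N.

Definition total d (n : 'I_d -> nat) : nat := (\prod_i n i)%N.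

Definition m d (n : 'I_d -> nat) (v : ivec d) : rat :=
  \prod_j ((n j)%:R : rat) ^ (- v j 0).

Definition base_rep d (n : 'I_d -> nat) (a : nat) (v1 v2 : ivec d)
    (a0 a1 a2 : nat) : Prop :=
  [/\ (a%:R : rat) = a0%:R + a1%:R * m n v1 + a2%:R * m n v2,
      (a0%:R : rat) < m n v1
    & (a1%:R : rat) < m n v2 / m n v1].

(* [xget x0 P] is an element of [P] when [P] is inhabited, and [x0] otherwise;
   [base_repP] below shows that the middle digit exists and is unique whenever
   v2 <= v1 <= 0. *)
Definition base2 d (n : 'I_d -> nat) (a : nat) (v1 v2 : ivec d) : nat :=
  xget 0%N [set a1 | exists a0 a2, base_rep n a v1 v2 a0 a1 a2]%classic.

(* A function on the pairs v1 >= v2 in {-1,0}^d is represented by a function on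
   all pairs of vectors that vanishes off this domain, so that Leibniz equality
   of cubes is agreement on the domain. *)
Definition cube_dom d (v1 v2 : ivec d) : bool :=
  [&& vle (- ones d) v2, vle v2 v1 & vle v1 0].

Definition cubefun d := ivec d -> ivec d -> nat.

Definition cube d (n : 'I_d -> nat) (a : nat) : cubefun d :=
  fun v1 v2 => if cube_dom v1 v2 then base2 n a v1 v2 else 0%N.

Definition tile_set d (n : 'I_d -> nat) : set (cubefun d) :=
  [set cube n a | a in [set a | (a < total n)%N]]%classic.

Definition config d := ivec d -> cubefun d.

Definition X d (n : 'I_d -> nat) : set (config d) :=
  [set f | (forall z, tile_set n (f z)) /\
           (forall z i, f z 0 (- ones d + basis_vec i) =
                        f (z + basis_vec i) (- basis_vec i) (- ones d))]%classic.

(* Label of the edge {z - e_i, z}. *)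
Definition edge_label d (f : config d) (z : ivec d) (i : 'I_d) : nat :=
  f z 0 (- basis_vec i).

Definition unit_step d (p p' : ivec d) : bool :=
  [exists j, (p' - p == basis_vec j) || (p' - p == - basis_vec j)].

(* For a unit step, exactly one pair (j, a) satisfies p' - p = a e_j, and the
   upper end of the edge {p, p'} is the maximum of p and p'. *)
Definition step_value d (n : 'I_d -> nat) (f : config d) (p p' : ivec d) : rat :=
  \sum_j \sum_(a <- [:: 1; -1] : seq int | p' - p == a *: basis_vec j)
     a%:~R * m n (vmax p p') * (edge_label f (vmax p p') j)%:R.

(* The path p = P_1, P_2, ..., P_k = p' is encoded by p and s = [P_2; ...; P_k]. *)
Definition path_between d (p p' : ivec d) (s : seq (ivec d)) : Prop :=
  path (@unit_step d) p s /\ last p s = p'.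

Definition path_value d (n : 'I_d -> nat) (f : config d) (p : ivec d)
    (s : seq (ivec d)) : rat :=
  \sum_(e <- zip (p :: s) s) step_value n f e.1 e.2.

(* For f in X n the value does not depend on the path that is chosen. *)
Definition displacement d (n : 'I_d -> nat) (f : config d) (p p' : ivec d) : rat :=
  path_value n f p (xget [::] [set s | path_between p p' s]%classic).

Definition label d (n : 'I_d -> nat) (f : config d) (p p' : ivec d) : rat :=
  displacement n f p p' / m n p'.

(* For f in X n and p <= p' the label is a natural number, which [Num.truncn]
   merely retypes. *)
Definition nat_label d (n : 'I_d -> nat) (f : config d) (p p' : ivec d) : nat :=
  Num.truncn (label n f p p').

Definition mxact d d' (A : 'M[nat]_(d, d')) (z : ivec d') : ivec d :=
  map_mx Posz A *m z.

Definition prebasis_pow d d' (n : 'I_d -> nat) (A : 'M[nat]_(d, d')) :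
    'I_d' -> nat :=
  fun i => (\prod_j n j ^ A j i)%N.

Definition macrotile d d' (A : 'M[nat]_(d, d')) (n : 'I_d -> nat)
    (f : config d) : config d' :=
  fun v => cube (prebasis_pow n A)
                (nat_label n f (mxact A (v - ones d')) (mxact A v)).

Definition microtile_choice d d' (A : 'M[nat]_(d, d')) (x : ivec d)
    (z1 z2 : ivec d') : Prop :=
  [/\ vle 0 (mxact A z1 - x), vle z2 z1 & vle (mxact A z2) (x - ones d)].

(* For f in X (prebasis_pow n A) the value does not depend on the pair (z1, z2)
   that is chosen. *)
Definition microtile d d' (A : 'M[nat]_(d, d')) (n : 'I_d -> nat)
    (f : config d') : config d :=
  fun x =>
    let z := xget (0, 0) [set z | microtile_choice A x z.1 z.2]%classic in
    let v := mxact A z.1 - x in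
    let a := nat_label (prebasis_pow n A) f z.2 z.1 in
    cube n (base2 n a (- v) (- v - ones d)).

Lemma prebasis_powE d d' (n : 'I_d -> nat) (A : 'M[nat]_(d, d')) (i : 'I_d') :
  (prebasis_pow n A i)%:R = m n (- mxact A (basis_vec i)).
Proof.
rewrite /prebasis_pow /m /mxact /basis_vec -colE natr_prod; apply: eq_bigr => j _.
by rewrite !mxE opprK natrX.
Qed.

Definition mnat d (n : 'I_d -> nat) (v : ivec d) : nat :=
  (\prod_j n j ^ `|v j 0%R|)%N.

Lemma mnatE d (n : 'I_d -> nat) (v : ivec d) : vle v 0 -> (mnat n v)%:R = m n v.
Proof.
move=> /forallP v0; rewrite /mnat /m natr_prod; apply: eq_bigr => j _.
have := v0 j; rewrite mxE natrX => vj0.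
by rewrite -[in RHS](ler0_norm vj0).
Qed.

Lemma mnat_gt0 d (n : 'I_d -> nat) (v : ivec d) : prebasis n -> (0 < mnat n v)%N.
Proof. by move=> n0; rewrite prodn_gt0 // => j; rewrite expn_gt0 n0. Qed.

Lemma mnat_dvd d (n : 'I_d -> nat) (v1 v2 : ivec d) :
  vle v2 v1 -> vle v1 0 -> (mnat n v1 %| mnat n v2)%N.
Proof.
move=> /forallP v21 /forallP v10.
apply: (big_ind2 (fun x y => (x %| y)%N)) => // [*|j _]; first exact: dvdn_mul.
have := v21 j; have := v10 j; rewrite !mxE => h1 h2.
by apply: dvdn_exp2l; lia.
Qed.

Lemma base_repP d (n : 'I_d -> nat) (a : nat) (v1 v2 : ivec d) (a0 a1 a2 : nat) :
  prebasis n -> vle v2 v1 -> vle v1 0 ->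
  base_rep n a v1 v2 a0 a1 a2 <->
  [/\ a0 = a %% mnat n v1, a1 = (a %/ mnat n v1) %% (mnat n v2 %/ mnat n v1)
    & a2 = a %/ mnat n v2]%N.
Proof.
move=> n0 v21 v10.
have v20 : vle v2 0.
  by apply/forallP => i; apply: le_trans (forallP v21 i) (forallP v10 i).
have := mnat_gt0 v1 n0; have := mnat_gt0 v2 n0; have := mnat_dvd n v21 v10.
rewrite /base_rep -!mnatE //; set k1 := mnat n v1; set k2 := mnat n v2.
move=> /dvdnP[q ->]; rewrite muln_gt0 => /andP[q0 _] k10.
have k1u : (k1%:R : rat) != 0 by rewrite pnatr_eq0 -lt0n.
rewrite natrM mulfK // -!natrM -!natrD !ltr_nat mulnK //.
split=> [[/eqP + a0k a1q]|[-> -> ->]].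
  rewrite eqr_nat => /eqP ->.
  have -> : (a0 + a1 * k1 + a2 * (q * k1) = (a2 * q + a1) * k1 + a0)%N by lia.
  rewrite modnMDl modn_small // divnMDl // (divn_small a0k) addn0.
  rewrite modnMDl modn_small // [(q * k1)%N]mulnC divnMA.
  by rewrite !divnMDl // (divn_small a0k) addn0 divnMDl // divn_small // addn0.
split; rewrite ?ltn_mod //; congr (_%:R).
rewrite {1}(divn_eq a k1) {1}(divn_eq (a %/ k1) q) [(q * k1)%N]mulnC divnMA.
by lia.
Qed.

Lemma base2E d (n : 'I_d -> nat) (a : nat) (v1 v2 : ivec d) :
  prebasis n -> vle v2 v1 -> vle v1 0 ->
  base2 n a v1 v2 = ((a %/ mnat n v1) %% (mnat n v2 %/ mnat n v1))%N.
Proof.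
move=> n0 v21 v10; apply: xget_unique => [|b [a0 [a2]]].
  by exists (a %% mnat n v1)%N, (a %/ mnat n v2)%N; apply/base_repP.
by move=> /base_repP[].
Qed.

Lemma path_between_exists d (p p' : ivec d) : exists s, path_between p p' s.
Proof.
have [k] := ubnP (\sum_i `|(p' - p)%R i 0%R|)%N; elim: k p => // k IHk p ltk.
have [-> | ne] := eqVneq p p'; first by exists [::].
have [j nej] : exists j, (p' - p) j 0 != 0.
  apply: contrapT => noj; move/eqP: ne; apply; apply/eqP; rewrite eq_sym -subr_eq0.
  apply/eqP/colP => j; rewrite [RHS]mxE; apply/eqP; apply: contrapT => /negP nj.
  by apply: noj; exists j.
pose a : int := if 0 < (p' - p) j 0 then 1 else -1.
pose q := p + a *: basis_vec j.
have stepq : unit_step p q.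
  apply/existsP; exists j; rewrite /q addrC addKr /a.
  by case: ifP => _; rewrite ?scale1r ?scaleN1r eqxx ?orbT.
have [|s [sp sl]] := IHk q; last by exists (q :: s); split; rewrite /= ?stepq.
suff : (\sum_i `|(p' - q)%R i 0%R| < \sum_i `|(p' - p)%R i 0%R|)%N by lia.
rewrite (bigD1 j) // [X in (_ < X)%N](bigD1 j) //=.
rewrite (eq_bigr (fun i => `|(p' - p)%R i 0%R|%N)) => [|i ij].
  rewrite ltn_add2r; move: nej; rewrite /q /a !mxE !eqxx /=.
  by case: ifP; lia.
by rewrite /q !mxE (negPf ij) mulr0 addr0.
Qed.

Lemma microtile_choice_exists d d' (A : 'M[nat]_(d, d')) (x : ivec d) :
  (forall i, exists j, (0 < A i j)%N) ->
  exists z1 z2, microtile_choice A x z1 z2.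
Proof.
move=> A0; pose k : int := (\sum_i `|x i 0%R|)%N.+1.
have ltk i : `|x i 0| < k.
  by rewrite -abszE /k (bigD1 i) //= ltz_nat ltnS leq_addr.
have k0 : 0 <= k by [].
move: k ltk k0 => k ltk k0.
have Ak i : k <= \sum_j (A i j)%:Z * k.
  have [j Aij] := A0 i; rewrite (bigD1 j) //=.
  rewrite -[leLHS]addr0 lerD ?ler_peMl ?sumr_ge0 // => l _.
  by rewrite mulr_ge0.
have E c i : mxact A (const_mx c : ivec d') i 0 = \sum_j (A i j)%:Z * c.
  by rewrite mxE; apply: eq_bigr => j _; rewrite !mxE.
exists (const_mx k), (const_mx (- k)); split; apply/forallP => i.
- rewrite mxE [leRHS]mxE E [(- x) i 0]mxE.
  by rewrite subr_ge0 (le_trans _ (Ak i)) // ltW // (le_lt_trans (ler_norm _)).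
- by rewrite !mxE; lia.
- rewrite E [leRHS]mxE [(- ones d) i 0]mxE [ones d i 0]mxE.
  under eq_bigr do rewrite mulrN.
  rewrite sumrN lerNl opprB; apply: le_trans (Ak i).
  rewrite lez1D (le_lt_trans _ (ltk i)) //.
  by rewrite -normrN ler_norm.
Qed.

(* Main.v *)
(* A configuration f in X_n is the same thing as a height function H on Z^d, up
   to a constant: H(z) - H(z - e_i) = m(n,z) c with a digit c < n[i]. The
   matching rule of X_n says exactly that the increments
   m(n,z) lambda(f,{z-e_i,z}) are curl-free, hence integrate to H; conversely,
   the cube at z lists the base-n digits of (H(z) - H(z-1)) / m(n,z), and
   (p,p')f = H(p') - H(p). In terms of heights, M_{A,n} is H |-> H o A, because
   m(n^A,v) = m(n,Av). A height G for n^A extends along A in only one way: if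
   A z2 <= x <= A z1, then G(z1) - H(x) lies in [0, m(n,x)) and H(x) - G(z2) is
   a multiple of m(n,x), so H(x) is G(z2) plus G(z1) - G(z2) rounded down to a
   multiple of m(n,x). Truncating digits in this way is mu_{A,n}. *)

Require Import Defs.
From mathcomp Require Import all_boot all_order all_algebra.
From mathcomp Require Import zify ring.
From mathcomp Require Import boolp classical_sets functions.

Set Implicit Arguments.
Unset Strict Implicit.
Unset Printing Implicit Defensive.
Import Order.TTheory GRing.Theory Num.Theory.
Local Open Scope ring_scope.

(** * Integration of curl-free increments on Z^d *)

(** The antiderivative that vanishes at 0. As [Negz t] is -(t+1), the second sum runs over r(0),
    ..., r(-t). *)
Definition int_antidiff (V : zmodType) (r : int -> V) (z : int) : V :=
  match z with
  | Posz t => \sum_(s < t) r s.+1%:Z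
  | Negz t => - \sum_(s < t.+1) r (- s%:Z)
  end.

Lemma int_antidiffE (V : zmodType) (r : int -> V) (z : int) :
  int_antidiff r z - int_antidiff r (z - 1) = r z.
Proof.
case: z => [[|t]|t].
- by rewrite sub0r /= big_ord0 big_ord1 sub0r opprK.
- have -> : t.+1%:Z - 1 = t%:Z by lia.
  by rewrite /= big_ord_recr /= [LHS]addrC addKr.
have -> : Negz t - 1 = Negz t.+1 by lia.
by rewrite /= opprK [X in _ + X]big_ord_recr /= addKr NegzE.
Qed.

(** Integrate [r] along every line parallel to e_k, from the hyperplane where coordinate k is 0. A
    shift w within that hyperplane permutes these lines, so S inherits any such invariance of r. *)
Lemma line_antidiff (V : zmodType) d (r : ivec d -> V) (k : 'I_d) :
  exists S : ivec d -> V, (forall q, S q - S (q - basis_vec k) = r q) /\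
    (forall w : ivec d, w k 0 = 0 -> (forall q, r (q - w) = r q) ->
       forall q, S (q - w) = S q).
Proof.
pose l (q : ivec d) z := r (q - q k 0 *: basis_vec k + z *: basis_vec k).
exists (fun q => int_antidiff (l q) (q k 0)); split=> [q|w wk rw q].
  have -> : l (q - basis_vec k) = l q.
    apply: funext => z; rewrite /l; congr r; congr (_ + _).
    by rewrite !mxE !eqxx scalerBl scale1r opprB addrA subrK.
  rewrite !mxE !eqxx int_antidiffE /l; congr r.
  by rewrite subrK.
have -> : l (q - w) = l q.
  apply: funext => z; rewrite /l !mxE wk subr0.
  by rewrite [q - w - _]addrAC [X in r X]addrAC rw.
by rewrite !mxE wk subr0.
Qed.

(** Discrete Poincare lemma: the hypothesis says that the increments around every unit square
    cancel. *)
Lemma potential_exists (V : zmodType) d (g : 'I_d -> ivec d -> V) :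
  (forall i j q, g i q + g j (q - basis_vec i) =
                 g j q + g i (q - basis_vec j)) ->
  exists H : ivec d -> V, forall i q, H q - H (q - basis_vec i) = g i q.
Proof.
move=> curl.
suff all k : exists H : ivec d -> V,
    forall (i : 'I_d) q, (i < k)%N -> H q - H (q - basis_vec i) = g i q.
  by have [H HE] := all d; exists H => i q; apply: HE.
(* Once H handles the directions below k, the error r in direction k is
   invariant under them, so integrating r along e_k does not disturb them. *)
elim: k => [|k [H HE]]; first by exists (fun=> 0).
have [dk|kd] := leqP d k.
  by exists H => i q _; apply: HE; apply: leq_trans dk.
pose j := Ordinal kd.
pose r q := g j q - (H q - H (q - basis_vec j)).
have [S [SE Sinv]] := line_antidiff r j.
exists (fun q => H q + S q) => i q; rewrite ltnS leq_eqVlt => /orP[/eqP ik|ik].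
  have -> : i = j by apply: val_inj.
  by rewrite opprD addrACA SE /r addrC subrK.
rewrite Sinv; first by rewrite opprD addrACA subrr addr0 HE.
  rewrite !mxE andbT; case: eqP => // ji.
  by move: ik; rewrite -ji ltnn.
(* Invariance of [r] under e_i is the curl identity for (i, j), with g i replaced by the increments
   of H. *)
move=> p; rewrite /r.
have e1 := HE i p ik; have e2 := HE i (p - basis_vec j) ik.
have c := curl i j p; rewrite -e1 -e2 in c.
have -> : p - basis_vec i - basis_vec j = p - basis_vec j - basis_vec i.
  by rewrite addrAC.
have {}c := canRL (addKr _) c.
have alg (a b u x w : V) : - (a - b) + (u + (x - w)) - (b - w) = u + (x - a).
  rewrite !opprB [b - a + _]addrC -!addrA; do 2!congr (_ + _).
  by rewrite [b + _]addrC [- a + _]addrA subrK addrCA addNr addr0.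
by rewrite c alg opprB.
Qed.

(* [mxE] leaves int behind a canonical structure, which [lia] does not see
   through; hence these instances. *)
Lemma vec_addE d (u v : ivec d) i : (u + v) i 0 = u i 0 + v i 0.
Proof. exact: mxE. Qed.
Lemma vec_oppE d (u : ivec d) i : (- u) i 0 = - u i 0.
Proof. exact: mxE. Qed.
Lemma vec_zeroE d i : (0 : ivec d) i 0 = 0.
Proof. exact: mxE. Qed.
Lemma vec_onesE d i : ones d i 0 = 1.
Proof. exact: mxE. Qed.
Lemma vec_basisE d (i j : 'I_d) : basis_vec i j 0 = ((i == j) : nat)%:Z.
Proof. by rewrite mxE andbT eq_sym natz. Qed.
Lemma vec_maxE d (u v : ivec d) i :
  vmax u v i 0 = Num.max (u i 0) (v i 0).
Proof. exact: mxE. Qed.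
Definition vecE :=
  (vec_addE, vec_oppE, vec_zeroE, vec_onesE, vec_basisE, vec_maxE).

(** * Order and weights on Z^d *)

Lemma vleP d (u v : ivec d) : reflect (forall i, u i 0 <= v i 0) (vle u v).
Proof. exact: forallP. Qed.

Lemma vle_trans d : transitive (@vle d).
Proof.
by move=> v u w /vleP uv /vleP vw; apply/vleP => i; apply: le_trans (vw i).
Qed.

Lemma vle_sub d (u v : ivec d) : vle u v -> vle (u - v) 0.
Proof. by move=> /vleP uv; apply/vleP => i; rewrite !vecE subr_le0. Qed.

Section Weights.
Variables (d : nat) (n : 'I_d -> nat).
Hypothesis n0 : prebasis n.

Lemma mD (u v : ivec d) : m n (u + v) = m n u * m n v.
Proof.
rewrite /m -big_split; apply: eq_bigr => j _ /=.
by rewrite !mxE opprD expfzDr // pnatr_eq0 -lt0n.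
Qed.

Lemma m_gt0 (v : ivec d) : 0 < m n v.
Proof. by apply: prodr_gt0 => j _; rewrite exprz_gt0 // ltr0n. Qed.

Lemma m_neq0 (v : ivec d) : m n v != 0.
Proof. by rewrite gt_eqF ?m_gt0. Qed.

Lemma mnat_basis (i : 'I_d) : mnat n (- basis_vec i) = n i.
Proof.
rewrite /mnat (bigD1 i) //= !mxE !eqxx big1 ?muln1 // => j ji.
by rewrite !mxE (negPf ji).
Qed.

Lemma mnat_ones : mnat n (- ones d) = Defs.total n.
Proof. by apply: eq_bigr => i _; rewrite !mxE. Qed.

Lemma basis_le0 (i : 'I_d) : vle (- basis_vec i) 0.
Proof. by apply/vleP => j; rewrite !mxE; case: eqP. Qed.

Lemma m_basis (i : 'I_d) : m n (- basis_vec i) = (n i)%:R.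
Proof. by rewrite -mnatE ?basis_le0 // mnat_basis. Qed.

Lemma mnat0 : mnat n 0 = 1%N.
Proof. by rewrite /mnat big1 // => i _; rewrite mxE. Qed.

Lemma mnatD (u v : ivec d) :
  vle u 0 -> vle v 0 -> mnat n (u + v) = (mnat n u * mnat n v)%N.
Proof.
move=> u0 v0; have uv0 : vle (u + v) 0.
  move/vleP: u0 => u0; move/vleP: v0 => v0; apply/vleP => i.
  by have := u0 i; have := v0 i; rewrite !vecE; lia.
by apply/eqP; rewrite -(eqr_nat rat) natrM !mnatE // mD.
Qed.

Lemma m_scale (u v : ivec d) : vle u v -> m n u = m n v * (mnat n (u - v))%:R.
Proof. by move=> uv; rewrite mnatE ?vle_sub // -mD addrC subrK. Qed.

End Weights.

(** Induction on the l1-distance: where p and q differ in coordinate i, p lies strictly below q, so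
    q - e_i is still above p. *)
Lemma vle_ind d (P : ivec d -> ivec d -> Prop) :
  (forall p, P p p) ->
  (forall p q i, vle p (q - basis_vec i) -> P p (q - basis_vec i) -> P p q) ->
  forall p q, vle p q -> P p q.
Proof.
move=> P0 PS p q; have [k] := ubnP (\sum_i `|(q - p)%R i 0%R|)%N.
elim: k q => // k IHk q ltk pq.
have [<- // | ne] := eqVneq p q.
have [i nei] : exists i, p i 0 != q i 0.
  apply: contrapT => noi; move/eqP: ne; apply; apply/colP => i.
  by apply/eqP; apply: contrapT => /negP ni; apply: noi; exists i.
have pqi : vle p (q - basis_vec i).
  apply/vleP => j; have := vleP _ _ pq j; rewrite !vecE.
  by case: (eqVneq i j) nei => [->|_ _]; lia.
apply: (PS _ _ i) => //; apply: IHk => //.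
suff : (\sum_j `|(q - basis_vec i - p)%R j 0%R| < \sum_j `|(q - p)%R j 0%R|)%N.
  by move=> h; apply: leq_trans h _; rewrite -ltnS.
rewrite (bigD1 i) // [X in (_ < X)%N](bigD1 i) //=.
rewrite (eq_bigr (fun j => `|(q - p)%R j 0%R|%N)) => [|j ij].
  rewrite ltn_add2r; have := vleP _ _ pq i; move: nei; rewrite !vecE !eqxx /=.
  by lia.
by rewrite !mxE (negPf ij) subr0.
Qed.

(** * Height functions and their configurations *)

Definition height d (n : 'I_d -> nat) (H : ivec d -> rat) : Prop :=
  forall q i, exists2 c, (c < n i)%N &
    H q - H (q - basis_vec i) = m n q * c%:R.

(** For a height the quotient is a natural number, by [height_truncn], so [Num.truncn] only changes
    its type. *)
Definition height_config d (n : 'I_d -> nat) (H : ivec d -> rat) : config d :=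
  fun z => cube n (Num.truncn ((H z - H (z - ones d)) / m n z)).

Lemma ltn_digits (k l a b : nat) : (a < k -> b < l -> a + b * k < l * k)%N.
Proof.
move=> ak bl; apply: (@leq_trans (b.+1 * k)); first by lia.
by rewrite leq_mul2r bl orbT.
Qed.

(** Edges are added one at a time at the upper end. Since m(n,q-e_i) = n[i] m(n,q), the new edge
    contributes the lowest mixed-radix digit. *)
Lemma height_le d (n : 'I_d -> nat) (H : ivec d -> rat) (p q : ivec d) :
  prebasis n -> height n H -> vle p q ->
  exists2 c, (c < mnat n (p - q))%N & H q - H p = m n q * c%:R.
Proof.
move=> n0 hH; move: p q; apply: vle_ind => [p|p q i pq [c2 c2lt c2E]].
  by exists 0%N; rewrite subrr ?mnat0 // mulr0.
have [c1 c1lt c1E] := hH q i; exists (c1 + c2 * n i)%N.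
  have -> : p - q = p - (q - basis_vec i) + - basis_vec i.
    by rewrite opprB addrA addrAC addrK.
  rewrite mnatD ?basis_le0 ?vle_sub // mnat_basis.
  exact: ltn_digits.
have -> : H q - H p = (H q - H (q - basis_vec i)) + (H (q - basis_vec i) - H p).
  by ring.
rewrite c1E c2E mD // m_basis // natrD natrM; ring.
Qed.

Lemma cube_domE d (n : 'I_d -> nat) a (v1 v2 : ivec d) : cube_dom v1 v2 ->
  cube n a v1 v2 = base2 n a v1 v2.
Proof. by rewrite /cube => ->. Qed.

Lemma base2_uniq d (n : 'I_d -> nat) (a : nat) (v1 v2 : ivec d) a0 a1 a2 :
  prebasis n -> vle v2 v1 -> vle v1 0 ->
  base_rep n a v1 v2 a0 a1 a2 -> base2 n a v1 v2 = a1.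
Proof.
move=> n0 v21 v10 /(base_repP _ _ _ _ n0 v21 v10)[_ -> _].
by rewrite base2E.
Qed.

Lemma basis_inj d (i j : 'I_d) (a b : int) : b != 0 ->
  a *: basis_vec i = b *: basis_vec j -> i = j /\ a = b.
Proof.
move=> b0 /matrixP /(_ j 0); rewrite !mxE !eqxx andbT mulr1 eq_sym.
case: eqP => [-> /=|_ /=]; first by rewrite mulr1.
by rewrite mulr0 => e; rewrite -e in b0.
Qed.

Section Height.
Variables (d : nat) (n : 'I_d -> nat) (H : ivec d -> rat).
Hypotheses (n0 : prebasis n) (hH : height n H).

Lemma height_truncn (p q : ivec d) : vle p q ->
  m n q * (Num.truncn ((H q - H p) / m n q))%:R = H q - H p.
Proof.
move=> pq; have [c _ ->] := height_le n0 hH pq.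
by rewrite mulrAC divff ?m_neq0 // mul1r natrK.
Qed.

(** Descending from z through z+v1 and z+v2 to z-1 splits H(z) - H(z-1) into three drops. Up to the
    factor m(n,z) they are the terms of a base representation, whose uniqueness identifies the
    middle digit. *)
Lemma height_config_digit (z v1 v2 : ivec d) : cube_dom v1 v2 ->
  m n (z + v1) * (height_config n H z v1 v2)%:R = H (z + v1) - H (z + v2).
Proof.
move=> dom; have /and3P[v2m v21 v10] := dom.
have h10 : vle (z + v1) z.
  by apply/vleP => i; have := vleP _ _ v10 i; rewrite !vecE; lia.
have h21 : vle (z + v2) (z + v1).
  by apply/vleP => i; have := vleP _ _ v21 i; rewrite !vecE; lia.
have hm2 : vle (z - ones d) (z + v2).
  by apply/vleP => i; have := vleP _ _ v2m i; rewrite !vecE; lia.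
have [c0 c0lt c0E] := height_le n0 hH h10.
have [c1 c1lt c1E] := height_le n0 hH h21.
have [c2 _ c2E] := height_le n0 hH hm2.
rewrite c1E; congr (_ * _%:R); rewrite /height_config cube_domE //.
apply: (base2_uniq (a0 := c0) (a2 := c2)) => //.
have z1z : vle (z - ones d) z by apply/vleP => i; rewrite !vecE; lia.
have tE := height_truncn z1z.
rewrite [z + v1]addrC addrK in c0lt.
have v1v2 : z + v2 - (z + v1) = v2 - v1 by rewrite opprD addrACA subrr add0r.
rewrite v1v2 in c1lt.
split.
- apply: (mulfI (m_neq0 n0 z)); rewrite tE !mulrDr.
  have -> : H z - H (z - ones d) = (H z - H (z + v1)) +
     (H (z + v1) - H (z + v2)) + (H (z + v2) - H (z - ones d)) by ring.
  by rewrite c0E c1E c2E !mD //; ring.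
- by rewrite -mnatE // ltr_nat.
- rewrite -[v2 in ltRHS](subrK v1) mD // mulfK ?m_neq0 //.
  by rewrite -mnatE ?vle_sub // ltr_nat.
Qed.

Lemma cube_dom0 (v : ivec d) : vle (- ones d) v -> vle v 0 -> cube_dom 0 v.
Proof. by move=> h1 h2; rewrite /cube_dom h1 h2; apply/vleP. Qed.

Lemma X_height_config : X n (height_config n H).
Proof.
split=> [z|z i].
  exists (Num.truncn ((H z - H (z - ones d)) / m n z)) => //=.
  have z1z : vle (z - ones d) z by apply/vleP => i; rewrite !vecE; lia.
  have [c] := height_le n0 hH z1z.
  rewrite [z - _]addrC addrK mnat_ones => clt ->.
  by rewrite mulrAC divff ?m_neq0 // mul1r natrK.
(* Both sides of the matching rule, times m(n,z), equal H(z) - H(z-1+e_i). *)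
apply/eqP; rewrite -(eqr_nat rat); apply/eqP; apply: (mulfI (m_neq0 n0 z)).
have d1 : cube_dom 0 (- ones d + basis_vec i).
  by apply: cube_dom0; apply/vleP => j; rewrite !vecE; lia.
have d2 : cube_dom (- basis_vec i) (- ones d).
  by apply/and3P; split; apply/vleP => j; rewrite !vecE; lia.
have := height_config_digit z d1; rewrite addr0 => ->.
have := height_config_digit (z + basis_vec i) d2; rewrite addrK => ->.
by congr (_ - H _); rewrite -addrA [basis_vec i + _]addrC.
Qed.

Lemma edge_label_height (z : ivec d) (i : 'I_d) :
  m n z * (edge_label (height_config n H) z i)%:R = H z - H (z - basis_vec i).
Proof.
have := @height_config_digit z 0 (- basis_vec i); rewrite addr0; apply.
by apply: cube_dom0; rewrite ?basis_le0 //; apply/vleP => j; rewrite !vecE; lia.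
Qed.

(** Only the pair (j, b) with q - p = b e_j survives in the double sum, and the sign b orients the
    drop along the edge. *)
Lemma step_value_height (p q : ivec d) : unit_step p q ->
  step_value n (height_config n H) p q = H q - H p.
Proof.
move=> /existsP[j]; rewrite -[basis_vec j]scale1r -scaleNr => qp.
have [b bE qpE] : exists2 b : int, b \in [:: 1; -1] & q - p = b *: basis_vec j.
  by case/orP: qp => /eqP->; [exists 1 | exists (-1)].
have b0 : b != 0 by move: bE; rewrite !inE => /orP[]/eqP->.
rewrite /step_value (bigD1 j) //=.
rewrite [X in _ + X]big1 ?addr0 => [|i ij]; last first.
  rewrite big1_seq // => a /andP[/eqP aE _].
  rewrite qpE in aE; have [/eqP] := basis_inj b0 (esym aE).
  by rewrite (negPf ij).
have aE a : (q - p == a *: basis_vec j) = (a == b).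
  apply/eqP/eqP => [|->] //; rewrite qpE => /esym e.
  by have [] := basis_inj b0 e.
under eq_bigl do rewrite aE.
have -> : \sum_(a <- [:: 1; -1] : seq int | a == b) a%:~R * m n (vmax p q) *
    (edge_label (height_config n H) (vmax p q) j)%:R =
    b%:~R * (H (vmax p q) - H (vmax p q - basis_vec j)).
  rewrite -edge_label_height !big_cons big_nil.
  by move: bE; rewrite !inE => /orP[]/eqP->; rewrite /= addr0 mulrA.
move: bE qpE; rewrite !inE => /orP[]/eqP-> => [|] /(canRL (subrK _)) ->.
  rewrite scale1r; have -> : vmax p (basis_vec j + p) = p + basis_vec j.
    by apply/colP => i; rewrite !vecE; lia.
  by rewrite addrK [_ + p]addrC mul1r.
rewrite scaleN1r; have -> : vmax p (- basis_vec j + p) = p.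
  by apply/colP => i; rewrite !vecE; lia.
by rewrite [- _ + p]addrC mulN1r opprB.
Qed.

(** The sum telescopes along any path, so the choice made by [xget] is harmless;
    [path_between_exists] excludes the default. *)
Lemma displacement_height (p q : ivec d) :
  displacement n (height_config n H) p q = H q - H p.
Proof.
rewrite /displacement; case: xgetP => [s _ [+ <-]|noq]; last first.
  by have [s /noq] := path_between_exists p q.
rewrite /path_value; elim: s p => [|r s IHs] p /=.
  by rewrite big_nil subrr.
by case/andP => /step_value_height sE /IHs; rewrite big_cons /= sE => ->; ring.
Qed.

End Height.

(** * From configurations back to heights *)

Lemma modnM_digits (a k l : nat) : (0 < k)%N -> (0 < l)%N ->
  (a %% (l * k) = a %% k + (a %/ k) %% l * k)%N.
Proof.
move=> k0 l0; rewrite {1}(divn_eq a k) {1}(divn_eq (a %/ k) l).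
rewrite mulnDl -mulnA -addnA modnMDl addnC modn_small //.
by apply: ltn_digits; rewrite ltn_mod.
Qed.

(** The increment along e_i is the digit [a z %% n i] of the tile number [a z]. The matching rule
    makes these increments curl-free, so they integrate to H, and the drop over a whole cube
    recovers [a z]. *)
Lemma X_height d (n : 'I_d -> nat) (f : config d) : prebasis n -> X n f ->
  exists2 H, height n H & f = height_config n H.
Proof.
move=> n0 [tf adj].
have /choice[a fa] z : exists a, (a < Defs.total n)%N /\ cube n a = f z.
  by have [a aN <-] := tf z; exists a.
have fE z v1 v2 : cube_dom v1 v2 ->
    f z v1 v2 = ((a z %/ mnat n v1) %% (mnat n v2 %/ mnat n v1))%N.
  move=> dom; have /and3P[_ v21 v10] := dom.
  by have [_ <-] := fa z; rewrite cube_domE // base2E.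
(* Going down along e_i strips the base-n[i] digit from [a z]. The matching rule gives this for w =
   -1+e_i; reduction modulo a divisor gives the other w. *)
have adjE (z : ivec d) i w : vle (- ones d + basis_vec i) w -> vle w 0 ->
    (a (z - basis_vec i)%R %% mnat n w = (a z %/ n i) %% mnat n w)%N.
  move=> wi w0; have i0 : vle (- ones d + basis_vec i) 0 by apply: vle_trans w0.
  have dL := mnat_dvd n wi w0.
  have d1 : cube_dom 0 (- ones d + basis_vec i).
    by apply: cube_dom0 => //; apply/vleP => j; rewrite !vecE; lia.
  have d2 : cube_dom (- basis_vec i) (- ones d).
    by apply/and3P; split; apply/vleP => j; rewrite !vecE; lia.
  have N_E : mnat n (- ones d) = (n i * mnat n (- ones d + basis_vec i)%R)%N.
    rewrite -[in LHS](addrK (basis_vec i) (- ones d)) mnatD ?basis_le0 //.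
    by rewrite mnat_basis mulnC.
  have := adj (z - basis_vec i) i; rewrite subrK !fE // mnat0 !divn1 mnat_basis.
  rewrite N_E mulKn // [RHS]modn_small => [e|].
    by rewrite -(modn_dvdm _ dL) e.
  rewrite ltn_divLR // mulnC -N_E mnat_ones.
  by case: (fa z).
(* An edge followed by the box w makes the box w - e_i, and the two remainders join into one. *)
have stepE (z : ivec d) i w : vle (- ones d + basis_vec i) w -> vle w 0 ->
    m n z * (a z %% n i)%:R +
    m n (z - basis_vec i) * (a (z - basis_vec i)%R %% mnat n w)%:R =
    m n z * (a z %% mnat n (w - basis_vec i)%R)%:R.
  move=> wi w0; rewrite adjE // mnatD ?basis_le0 // mnat_basis.
  rewrite modnM_digits ?mnat_gt0 // mD // m_basis // natrD natrM; ring.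
have [H HE] : exists H : ivec d -> rat,
    forall i q, H q - H (q - basis_vec i) = m n q * (a q %% n i)%:R.
  apply: potential_exists => i j q.
  have [->//|ij] := eqVneq i j.
  (* Either way around a square yields the remainder modulo n[k] n[l], which is symmetric in k and
     l. *)
  have pairE k l : k != l -> m n q * (a q %% n k)%:R +
      m n (q - basis_vec k) * (a (q - basis_vec k)%R %% n l)%:R =
      m n q * (a q %% mnat n (- basis_vec l - basis_vec k)%R)%:R.
    move=> /negPf kl; rewrite -stepE ?basis_le0 ?mnat_basis //.
    apply/vleP => t; rewrite !vecE.
    by case: (eqVneq k t) => [<-|_]; rewrite 1?eq_sym ?kl; lia.
  have ji : j != i by rewrite eq_sym.
  by rewrite !pairE // [- basis_vec j - _]addrC.
(* From edges to every box inside the unit cube. Only p - q matters; two endpoints are kept so that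
   [vle_ind] applies. *)
have HvE p q : vle p q -> vle (- ones d) (p - q) -> forall z,
    H z - H (z + (p - q)) = m n z * (a z %% mnat n (p - q)%R)%:R.
  move: p q; apply: vle_ind => [p _ z|p q i pqi IH pq z].
    by rewrite subrr addr0 subrr mnat0 modn1 mulr0.
  pose w := p - (q - basis_vec i).
  have wE : p - q = w - basis_vec i by rewrite /w opprB addrA addrAC addrK.
  have wi : vle (- ones d + basis_vec i) w.
    by apply/vleP => k; have := vleP _ _ pq k; rewrite /w !vecE; lia.
  have w0 : vle w 0 by apply: vle_sub.
  have wm : vle (- ones d) w.
    by apply/vleP => k; have := vleP _ _ wi k; rewrite !vecE; lia.
  have := IH wm (z - basis_vec i); rewrite -/w => IHz.
  rewrite wE -stepE // -HE -IHz addrA [z + w - _]addrAC; ring.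
exists H.
  by move=> q i; exists (a q %% n i)%N; rewrite ?ltn_mod ?HE.
apply: funext => z; have [az <-] := fa z; congr cube.
(* The full box -1 gives all of [a z], because a z < N. *)
have := HvE (- ones d) 0; rewrite subr0 => ->; first last.
- by apply/vleP.
- by apply/vleP => k; rewrite !vecE.
by rewrite mnat_ones modn_small // mulrAC divff ?m_neq0 // mul1r natrK.
Qed.

(** * Heights under A and the macrotile map *)

Section Act.
Variables (d d' : nat) (n : 'I_d -> nat) (A : 'M[nat]_(d, d')).
Hypothesis n0 : prebasis n.

Lemma prebasis_pow_gt0 : prebasis (prebasis_pow n A).
Proof. by move=> i; rewrite prodn_gt0 // => j; rewrite expn_gt0 n0. Qed.

Lemma mxactB (u v : ivec d') : mxact A (u - v) = mxact A u - mxact A v.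
Proof. exact: mulmxBr. Qed.

Lemma mxact_ge0 (u : ivec d') : vle 0 u -> vle 0 (mxact A u).
Proof.
move=> /vleP u0; apply/vleP => i; rewrite vecE mxE sumr_ge0 // => j _.
by rewrite mxE mulr_ge0 //; have := u0 j; rewrite vecE.
Qed.

Lemma mxact_le (u v : ivec d') : vle u v -> vle (mxact A u) (mxact A v).
Proof.
move=> /vleP uv; have /vleP : vle 0 (mxact A (v - u)).
  by apply: mxact_ge0; apply/vleP => i; have := uv i; rewrite !vecE; lia.
rewrite mxactB => h; apply/vleP => i.
by have := h i; rewrite !vecE; lia.
Qed.

Lemma m_prebasis_pow (v : ivec d') : m (prebasis_pow n A) v = m n (mxact A v).
Proof.
pose c j : rat := (n j)%:R; have c0 j : c j != 0 by rewrite pnatr_eq0 -lt0n.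
have E j (F : 'I_d' -> int) : c j ^ (\sum_i F i) = \prod_i c j ^ F i.
  apply: (big_morph (fun k => c j ^ k)) => [k l|]; last exact: expr0z.
  exact: expfzDr.
rewrite /m; under [RHS]eq_bigr do rewrite -/(c _) mxE -sumrN E.
rewrite exchange_big; apply: eq_bigr => i _ /=.
rewrite natr_prod.
rewrite (big_morph (fun x : rat => x ^ (- v i 0)) (id1 := 1) (op1 := *%R)).
- by apply: eq_bigr => j _; rewrite natrX exprnP exprz_exp mxE mulrN.
- by move=> x y; apply: expfzMl.
- exact: exp1rz.
Qed.

Lemma mnat_prebasis_pow (v : ivec d') : vle v 0 ->
  mnat (prebasis_pow n A) v = mnat n (mxact A v).
Proof.
move=> v0; apply/eqP; rewrite -(eqr_nat rat); apply/eqP.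
rewrite !mnatE // ?m_prebasis_pow //.
by have := mxact_le v0; rewrite -[in X in vle _ X](subrr 0) mxactB subrr.
Qed.

Section Macro.
Variable H : ivec d -> rat.
Hypothesis hH : height n H.

(** An edge for n^A becomes the step from A(q-e_i) to Aq, which need not be an edge; [height_le]
    bounds its digit by the ratio of the end weights, which is n^A[i]. *)
Lemma height_mxact : height (prebasis_pow n A) (H \o mxact A).
Proof.
move=> q i /=.
have le : vle (mxact A (q - basis_vec i)) (mxact A q).
  by apply: mxact_le; apply/vleP => j; rewrite !vecE; lia.
have [c + ->] := height_le n0 hH le.
rewrite -mxactB [q - _]addrC addrK -mnat_prebasis_pow ?basis_le0 //.
by rewrite mnat_basis m_prebasis_pow; exists c.
Qed.

Lemma macrotile_height : macrotile A n (height_config n H) =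
  height_config (prebasis_pow n A) (H \o mxact A).
Proof.
apply: funext => v.
rewrite /macrotile /nat_label /label displacement_height //.
by rewrite /height_config /= m_prebasis_pow.
Qed.

End Macro.

(** * The height function behind the microtile map *)

Section Micro.
Variable G : ivec d' -> rat.
Hypothesis hG : height (prebasis_pow n A) G.

Definition micro_label (z1 z2 : ivec d') : nat :=
  Num.truncn ((G z1 - G z2) / m n (mxact A z1)).

(** The lower bound is x and not x - 1 as in [microtile_choice]: a choice for x then brackets every
    y from x - 1 to x. *)
Definition micro_bracket (x : ivec d) (z1 z2 : ivec d') : bool :=
  [&& vle z2 z1, vle (mxact A z2) x & vle x (mxact A z1)].

(** [micro_label] counts units of m(n,Az1); the quotient discards what lies below m(n,x). *)
Definition micro_value (x : ivec d) (z1 z2 : ivec d') : rat :=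
  G z2 + m n x * (micro_label z1 z2 %/ mnat n (x - mxact A z1))%:R.

Definition micro_height (x : ivec d) : rat :=
  let z := xget (0, 0) [set z | micro_bracket x z.1 z.2]%classic in
  micro_value x z.1 z.2.

Lemma height_pow_le (p q : ivec d') : vle p q ->
  exists2 c, (c < mnat n (mxact A p - mxact A q))%N &
    G q - G p = m n (mxact A q) * c%:R.
Proof.
move=> pq; have [c clt ->] := height_le prebasis_pow_gt0 hG pq.
exists c; last by rewrite m_prebasis_pow.
by rewrite -mxactB -mnat_prebasis_pow // vle_sub.
Qed.

Lemma micro_labelE z1 z2 : vle z2 z1 ->
  G z1 - G z2 = m n (mxact A z1) * (micro_label z1 z2)%:R.
Proof.
move=> z21; rewrite /micro_label; have [c _ ->] := height_pow_le z21.
by rewrite [X in Num.truncn X]mulrAC divff ?m_neq0 // mul1r natrK.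
Qed.

Lemma mnat_split (p q r : ivec d) : vle p q -> vle q r ->
  mnat n (p - r) = (mnat n (q - r) * mnat n (p - q))%N.
Proof.
move=> pq qr; rewrite -mnatD ?vle_sub //.
by rewrite [q - r + _]addrC addrA subrK.
Qed.

(** Raising z1 appends a low digit c < k, which the division removes. Lowering z2 adds b units of
    m(n,Az2), a multiple of m(n,x), which offsets the change from G z2 to G z2'. *)
Lemma micro_value_widen x z1 z2 z1' z2' : micro_bracket x z1 z2 ->
  vle z1 z1' -> vle z2' z2 -> micro_value x z1 z2 = micro_value x z1' z2'.
Proof.
move=> /and3P[z21 z2x xz1] z11 z22.
have z21' : vle z2' z1' by apply: vle_trans z22 (vle_trans z21 z11).
have [c clt cE] := height_pow_le z11; have [b _ bE] := height_pow_le z22.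
have aE := micro_labelE z21; have aE' := micro_labelE z21'.
set a := micro_label z1 z2 in aE *; set a' := micro_label z1' z2' in aE' *.
rewrite /micro_value -/a -/a'.
have A11 := mxact_le z11.
set k := mnat n (mxact A z1 - mxact A z1') in clt *.
set l := mnat n (x - mxact A z1); set e := mnat n (mxact A z2 - x).
have l0 : (0 < l)%N by apply: mnat_gt0.
have k0 : (0 < k)%N by apply: mnat_gt0.
have m1 : m n (mxact A z1) = m n (mxact A z1') * k%:R.
  by rewrite (m_scale n0 A11).
have mx : m n x = m n (mxact A z1) * l%:R by rewrite (m_scale n0 xz1).
have m2 : m n (mxact A z2) = m n x * e%:R by rewrite (m_scale n0 z2x).
(* The factors are ratios of weights: k = m(n,Az1)/m(n,Az1') and e l = m(n,Az2)/m(n,Az1). *)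
have a'E : a' = (c + (a + b * e * l) * k)%N.
  apply/eqP; rewrite -(eqr_nat rat); apply/eqP.
  apply: (mulfI (m_neq0 n0 (mxact A z1'))); rewrite -aE'.
  have -> : G z1' - G z2' =
    (G z1' - G z1) + (G z1 - G z2) + (G z2 - G z2') by ring.
  by rewrite cE aE bE m2 mx m1 !(natrD, natrM); ring.
have -> : mnat n (x - mxact A z1') = (k * l)%N by rewrite (mnat_split xz1 A11).
rewrite a'E divnMA addnC divnMDl // (divn_small clt) addn0 addnC divnMDl //.
have -> : G z2 = G z2' + m n x * e%:R * b%:R by rewrite -m2 -bE; ring.
by rewrite natrD natrM; ring.
Qed.

Lemma micro_heightE x z1 z2 : micro_bracket x z1 z2 ->
  micro_height x = micro_value x z1 z2.
Proof.
move=> xz; rewrite /micro_height.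
case: xgetP => [[u1 u2] _ /= xu|/(_ (z1, z2))//].
(* The two brackets have a common widening; w2 is the coordinatewise minimum. *)
pose w1 := vmax z1 u1; pose w2 := - vmax (- z2) (- u2).
rewrite (micro_value_widen (z1' := w1) (z2' := w2) xz).
- apply: micro_value_widen => //; apply/vleP => i; rewrite /w1 /w2 !vecE; lia.
- by apply/vleP => i; rewrite /w1 !vecE; lia.
- by apply/vleP => i; rewrite /w2 !vecE; lia.
Qed.

(** One pair brackets both x and y, so G z2 cancels; rounding the same label down to m(n,x) and to
    m(n,y) differs by a remainder. *)
Lemma micro_height_digit (x y : ivec d) z1 z2 : microtile_choice A x z1 z2 ->
  vle (x - ones d) y -> vle y x ->
  micro_height x - micro_height y = m n x *
    ((micro_label z1 z2 %/ mnat n (x - mxact A z1)) %% mnat n (y - x))%:R.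
Proof.
move=> [xz1 z21 z2x] xy yx.
have z2y : vle (mxact A z2) y by apply: vle_trans xy.
have {}xz1 : vle x (mxact A z1).
  by apply/vleP => i; have := vleP _ _ xz1 i; rewrite !vecE; lia.
rewrite (micro_heightE (z1 := z1) (z2 := z2)); last first.
  by rewrite /micro_bracket z21 xz1 (vle_trans z2y yx).
rewrite (micro_heightE (z1 := z1) (z2 := z2)); last first.
  by rewrite /micro_bracket z21 z2y (vle_trans yx xz1).
rewrite /micro_value (mnat_split yx xz1) divnMA (m_scale n0 yx).
set t := (_ %/ mnat n (x - _))%N; set r := mnat n (y - x).
rewrite {1}(divn_eq t r) natrD natrM; ring.
Qed.

Hypothesis A_rows : forall i, exists j, (0 < A i j)%N.

Lemma height_micro : height n micro_height.
Proof.
move=> q i; have [z1 [z2 zq]] := microtile_choice_exists q A_rows.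
rewrite (micro_height_digit (y := q - basis_vec i) zq).
- rewrite [q - _ - q]addrAC subrr add0r mnat_basis.
  by eexists; last reflexivity; rewrite ltn_mod.
- by apply/vleP => j; rewrite !vecE; lia.
- by apply/vleP => j; rewrite !vecE; lia.
Qed.

(** With v = Az1 - x, the digit read by [microtile] is the remainder in [micro_height_digit] for y =
    x - 1. *)
Lemma microtile_height :
  microtile A n (height_config (prebasis_pow n A) G) =
  height_config n micro_height.
Proof.
apply: funext => x; rewrite /microtile.
case: xgetP => [[z1 z2] _ /= zx|noz]; last first.
  by have [z1 [z2 /(noz (z1, z2))]] := microtile_choice_exists x A_rows.
have [xz1 _ _] := zx.
rewrite /nat_label /label displacement_height ?m_prebasis_pow //; last first.
  exact: prebasis_pow_gt0.
rewrite -/(micro_label z1 z2) opprB /height_config; congr cube.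
have xle : vle (x - mxact A z1) 0.
  by apply/vleP => i; have := vleP _ _ xz1 i; rewrite !vecE; lia.
have le1 : vle (- ones d) 0 by apply/vleP => i; rewrite !vecE.
rewrite base2E //; last by apply/vleP => i; rewrite !vecE; lia.
rewrite (mnatD n0 xle le1) mulKn ?mnat_gt0 //.
rewrite (micro_height_digit (y := x - ones d) zx); first last.
- by apply/vleP => i; rewrite !vecE; lia.
- by apply/vleP.
rewrite [x - _ - x]addrAC subrr add0r.
by rewrite mulrAC divff ?m_neq0 // mul1r natrK.
Qed.

(** * The two round trips *)

Lemma micro_height_mxact : micro_height \o mxact A = G.
Proof.
(* The bracket (v, v) has label 0, which leaves only G v. *)
apply: funext => v /=; rewrite (micro_heightE (z1 := v) (z2 := v)).
  by rewrite /micro_value /micro_label subrr mul0r truncn0 div0n mulr0 addr0.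
by rewrite /micro_bracket; apply/and3P; split; apply/vleP.
Qed.

End Micro.

(** The label between Az2 and Az1 is c1 + c2 l, where c1 < l measures H(Az1) - H(x) and c2 measures
    H(x) - H(Az2); division by l returns c2. *)
Lemma micro_height_comp (H : ivec d -> rat) :
  (forall i, exists j, (0 < A i j)%N) -> height n H ->
  micro_height (H \o mxact A) = H.
Proof.
move=> A_rows hH; apply: funext => x.
have [z1 [z2 [xz1 z21 z2x]]] := microtile_choice_exists x A_rows.
have {}xz1 : vle x (mxact A z1).
  by apply/vleP => i; have := vleP _ _ xz1 i; rewrite !vecE; lia.
have {}z2x : vle (mxact A z2) x.
  by apply/vleP => i; have := vleP _ _ z2x i; rewrite !vecE; lia.
rewrite (micro_heightE (height_mxact hH) (z1 := z1) (z2 := z2)); last first.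
  by rewrite /micro_bracket z21 z2x xz1.
have [c1 c1lt c1E] := height_le n0 hH xz1.
have [c2 _ c2E] := height_le n0 hH z2x.
rewrite /micro_value; set l := mnat n _ in c1lt *.
have -> : micro_label (H \o mxact A) z1 z2 = (c1 + c2 * l)%N.
  apply/eqP; rewrite -(eqr_nat rat); apply/eqP.
  apply: (mulfI (m_neq0 n0 (mxact A z1))).
  rewrite -(micro_labelE (height_mxact hH)) //=.
  have -> : H (mxact A z1) - H (mxact A z2) =
    (H (mxact A z1) - H x) + (H x - H (mxact A z2)) by ring.
  by rewrite c1E c2E (m_scale n0 xz1) -/l natrD natrM; ring.
rewrite addnC divnMDl ?mnat_gt0 // divn_small // addn0 -c2E /=; ring.
Qed.

End Act.

Theorem theorem4p38 (d d' : nat) (n : 'I_d -> nat) (A : 'M[nat]_(d, d'))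
    (n_prebasis : prebasis n)
    (A_rows : forall i : 'I_d, exists j : 'I_d', (0 < A i j)%N) :
  [/\ forall f : config d, X n f -> X (prebasis_pow n A) (macrotile A n f),
      forall f : config d', X (prebasis_pow n A) f -> X n (microtile A n f),
      forall f : config d, X n f -> microtile A n (macrotile A n f) = f
    & forall f : config d', X (prebasis_pow n A) f ->
        macrotile A n (microtile A n f) = f].
Proof.
have nA := prebasis_pow_gt0 A n_prebasis.
(* [X_height] turns every configuration into a height, so each claim becomes one about H composed
   with A or about [micro_height]. *)
split=> f /X_height[//|H hH ->].
- rewrite macrotile_height //; apply: X_height_config => //.
  exact: height_mxact.
- rewrite microtile_height //; apply: X_height_config => //.
  exact: height_micro.
- rewrite macrotile_height // microtile_height //; last exact: height_mxact.
  by rewrite micro_height_comp.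
- rewrite microtile_height // macrotile_height //; last exact: height_micro.
  by rewrite micro_height_mxact.
Qed.
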